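(* Let $\sigma$ be a relational signature. Let $U\subseteq\mathcal{M}(\mathrm{FO}(\sigma))$ be the image of the $\Gamma$-valued Stone pairing $A\mapsto\langle -,A\rangle_\Gamma$ on finite $\sigma$-structures, and $V\subseteq\mathcal{M}_I(\mathrm{FO}(\sigma))$ the image of the classical Stone pairing $A\mapsto\langle -,A\rangle_I$. Then $L_\gamma(\overline{U})=\overline{V}$, where the closures are taken in $\mathcal{M}(\mathrm{FO}(\sigma))$ and $\mathcal{M}_I(\mathrm{FO}(\sigma))$ respectively.
   Context: $\mathrm{FO}(\sigma)$ is the Lindenbaum–Tarski (Boolean) algebra of all first-order $\sigma$-formulas over variables $v_1,v_2,\dots$ modulo logical equivalence. $\Gamma$ is the set $\{r^-\mid r\in(0,1]\}\cup\{q^\circ\mid q\in\mathbb{Q}\cap[0,1]\}$, totally ordered by: $r^\circ<s^\circ$ iff $r<s$; $r^-<s^-$ iff $r<s$; $r^-<s^\circ$ iff $r\le s$; $s^\circ<r^-$ iff $s<r$; topologised by the subbasis $\{x\mid p^\circ\le x\}$ ($p\in\mathbb{Q}\cap[0,1]$), $\{x\mid x\le q^-\}$ ($q\in\mathbb{Q}\cap(0,1]$). Let $\mathrm{dom}=\{(x,y)\mid y\le x\}$; $\ominus$ on $\mathrm{dom}$: $r^\circ\ominus s^\circ=(r-s)^\circ$, $r^-\ominus s^\circ=(r-s)^-$, $r^\circ\ominus s^-=r^-\ominus s^-=(r-s)^\circ$ if $r-s\in\mathbb{Q}$ and $(r-s)^-$ otherwise; $x\oslash y=\bigvee\{x\ominus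 q^\circ\mid y<q^\circ\le x, q\in\mathbb{Q}\}$ (empty join $0^\circ$). For a bounded distributive lattice $D$, $\mathcal{M}(D)$ is the set of $\mu\colon D\to\Gamma$ with $\mu(0)=0^\circ$, $\mu(1)=1^\circ$, monotone, and $\mu(a)\oslash\mu(a\wedge b)\le\mu(a\vee b)\ominus\mu(b)$, $\mu(a)\ominus\mu(a\wedge b)\ge\mu(a\vee b)\oslash\mu(b)$ for all $a,b$, topologised as a subspace of $\Gamma^D$; $\mathcal{M}_I(D)$ is the set of finitely additive probability measures $m\colon D\to[0,1]$ (monotone, $m(0)=0$, $m(1)=1$, $m(a)+m(b)=m(a\vee b)+m(a\wedge b)$), topologised as a subspace of $[0,1]^D$. $L_\gamma(\mu)=\gamma\cdot\mu$ where $\gamma(r^-)=\gamma(r^\circ)=r$. Classical Stone pairing: $\langle\phi,A\rangle_I=|\{\bar a\in A^n\mid A\models\phi(\bar a)\}|/|A|^n$ for $\phi$ with free variables among $v_1,\dots,v_n$; $\Gamma$-valued Stone pairing: $\langle\phi,A\rangle_\Gamma=(\langle\phi,A\rangle_I)^\circ$ (a rational value, marked $\circ$). *)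

(* Defs.v *)
From HB Require Import structures.
From mathcomp Require Import all_boot all_order all_algebra.
From mathcomp Require Import all_classical all_reals all_analysis.

Set Implicit Arguments.
Unset Strict Implicit.
Unset Printing Implicit Defensive.

Import Order.TTheory GRing.Theory Num.Theory.
Import numFieldNormedType.Exports.

Local Open Scope classical_set_scope.
Local Open Scope ring_scope.
Local Open Scope quotient_scope.

(* The pair (r, false) encodes r^- and the pair (q, true) encodes q^o. *)
Definition Gamma_pred (R : realType) (p : R * bool) : bool :=
  if p.2 then (0 <= p.1 <= 1) && (p.1 \in @rational R) else 0 < p.1 <= 1.

Record Gamma (R : realType) :=
  MkGamma { Gamma_pair : R * bool; _ : Gamma_pred Gamma_pair }.

HB.instance Definition _ (R : realType) := [isSub for @Gamma_pair R].
HB.instance Definition _ (R : realType) := [Choice of Gamma R by <:].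

Definition gamma (R : realType) (x : Gamma R) : R := (Gamma_pair x).1.
Definition is_circ (R : realType) (x : Gamma R) : bool := (Gamma_pair x).2.

Lemma rational0 (R : realType) : @rational R 0.
Proof. by exists 0 => //; rewrite rmorph0. Qed.

Lemma rational1 (R : realType) : @rational R 1.
Proof. by exists 1 => //; rewrite rmorph1. Qed.

Lemma rationalB (R : realType) (x y : R) :
  rational x -> rational y -> rational (x - y).
Proof. by move=> [p _ <-] [q _ <-]; exists (p - q) => //; rewrite rmorphB. Qed.

Fact Gamma_zero_subproof (R : realType) : Gamma_pred ((0 : R), true).
Proof. by rewrite /Gamma_pred /= lexx ler01 /=; apply/mem_set/rational0. Qed.

Definition Gamma_zero (R : realType) : Gamma R :=
  MkGamma (Gamma_zero_subproof R).

(* Totalised constructors for q^o and r^-: they return 0^o when q (resp. r) is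
   not in the range required by Gamma. *)
Definition circ (R : realType) (q : R) : Gamma R :=
  insubd (Gamma_zero R) (q, true).
Definition minus (R : realType) (r : R) : Gamma R :=
  insubd (Gamma_zero R) (r, false).

Lemma gamma_inj (R : realType) (x y : Gamma R) :
  gamma x = gamma y -> is_circ x = is_circ y -> x = y.
Proof.
case: x y => [[r a] hx] [[s b] hy]; rewrite /gamma /is_circ /= => rs ab.
by apply: val_inj; rewrite /= rs ab.
Qed.

Lemma Gamma_circP (R : realType) (x : Gamma R) :
  is_circ x -> 0 <= gamma x <= 1 /\ rational (gamma x).
Proof.
case: x => [[r b] h]; rewrite /is_circ /gamma /= => bT; move: h.
by rewrite bT /Gamma_pred /= => /andP[-> /set_mem].
Qed.

Lemma Gamma_minusP (R : realType) (x : Gamma R) :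
  ~~ is_circ x -> 0 < gamma x <= 1.
Proof.
case: x => [[r b] h]; rewrite /is_circ /gamma /= => /negbTE bF.
by move: h; rewrite bF.
Qed.

Lemma gamma_ge0 (R : realType) (x : Gamma R) : 0 <= gamma x.
Proof.
have [/Gamma_circP[/andP[]]//|/Gamma_minusP/andP[/ltW]//] := boolP (is_circ x).
Qed.

Lemma gamma_le1 (R : realType) (x : Gamma R) : gamma x <= 1.
Proof.
have [/Gamma_circP[/andP[]]//|/Gamma_minusP/andP[]//] := boolP (is_circ x).
Qed.

Lemma Gamma_pair_insubd (R : realType) (p : R * bool) :
  Gamma_pair (insubd (Gamma_zero R) p) = if Gamma_pred p then p else (0, true).
Proof. exact: val_insubd. Qed.

Lemma Gamma_pair_circ (R : realType) (q : R) :
  0 <= q <= 1 -> rational q -> Gamma_pair (circ q) = (q, true).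
Proof.
move=> q01 ratq; rewrite /circ Gamma_pair_insubd.
by rewrite /Gamma_pred /= q01 (mem_set ratq).
Qed.

Lemma gamma_circ (R : realType) (q : R) :
  0 <= q <= 1 -> rational q -> gamma (circ q) = q.
Proof. by move=> q01 ratq; rewrite /gamma Gamma_pair_circ. Qed.

Lemma is_circ_circ (R : realType) (q : R) : is_circ (circ q).
Proof.
by rewrite /is_circ /circ Gamma_pair_insubd; case: ifP.
Qed.

Lemma Gamma_pair_minus (R : realType) (r : R) :
  0 < r <= 1 -> Gamma_pair (minus r) = (r, false).
Proof.
by move=> r01; rewrite /minus Gamma_pair_insubd /Gamma_pred /= r01.
Qed.

Lemma gamma_minus (R : realType) (r : R) : 0 < r <= 1 -> gamma (minus r) = r.
Proof. by move=> r01; rewrite /gamma Gamma_pair_minus. Qed.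

Lemma is_circ_minus (R : realType) (r : R) :
  0 < r <= 1 -> is_circ (minus r) = false.
Proof. by move=> r01; rewrite /is_circ Gamma_pair_minus. Qed.

Definition Gamma_lt (R : realType) (x y : Gamma R) : bool :=
  if ~~ is_circ x && is_circ y then gamma x <= gamma y else gamma x < gamma y.

Definition Gamma_le (R : realType) (x y : Gamma R) : bool :=
  (x == y) || Gamma_lt x y.

Fact Gamma_lt_irr (R : realType) : irreflexive (@Gamma_lt R).
Proof. by move=> x; rewrite /Gamma_lt andNb ltxx. Qed.

Fact Gamma_lt_trans (R : realType) : transitive (@Gamma_lt R).
Proof.
move=> y x z; rewrite /Gamma_lt.
case: (is_circ x); case: (is_circ y); case: (is_circ z) => /=;
  by [exact: lt_trans|exact: lt_le_trans|exact: le_lt_trans|exact: le_trans|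
      move=> h1 h2; apply: ltW; apply: lt_le_trans h1 h2|
      move=> h1 h2; apply: ltW; apply: le_lt_trans h1 h2|
      move=> h1 h2; apply: ltW; apply: lt_trans h1 h2].
Qed.

Fact Gamma_lt_total (R : realType) (x y : Gamma R) :
  x != y -> Gamma_lt x y || Gamma_lt y x.
Proof.
move=> xy; rewrite /Gamma_lt.
have [g|g|g] := ltgtP (gamma x) (gamma y).
- by rewrite ?if_same.
- by rewrite ?if_same orbT.
- case xc : (is_circ x); case yc : (is_circ y) => //=.
  + by case/eqP: xy; apply: gamma_inj; rewrite // xc.
  + by case/eqP: xy; apply: gamma_inj; rewrite // xc.
Qed.

Fact Gamma_display : Order.disp_t. Proof. exact: (Order.Disp tt tt). Qed.

HB.instance Definition _ (R : realType) := @Order.LtOrder.Build Gamma_display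
  (Gamma R) (@Gamma_le R) (@Gamma_lt R) _ _ (fun _ _ => erefl) (fun _ _ => erefl)
  (fun _ _ => erefl) (@Gamma_lt_irr R) (@Gamma_lt_trans R) (@Gamma_lt_total R).

Lemma Gamma_ltE (R : realType) (x y : Gamma R) : (x < y)%O =
  if ~~ is_circ x && is_circ y then gamma x <= gamma y else gamma x < gamma y.
Proof. by []. Qed.

Lemma Gamma_leE (R : realType) (x y : Gamma R) : (x <= y)%O =
  if is_circ x && ~~ is_circ y then gamma x < gamma y else gamma x <= gamma y.
Proof.
rewrite leNgt Gamma_ltE.
by case: (is_circ x); case: (is_circ y); rewrite /= -?ltNge -?leNgt.
Qed.

Lemma gamma_homo (R : realType) (x y : Gamma R) :
  (x <= y)%O -> gamma x <= gamma y.
Proof. by rewrite Gamma_leE; case: ifP => // _ /ltW. Qed.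

(* p^o ranges over the elements of Gamma marked with o, and q^-, for q rational,
   over the other elements of rational value. *)
Definition Gamma_subbasis (R : realType) : set (set (Gamma R)) :=
  [set B | (exists2 p : Gamma R, is_circ p & B = [set x | (p <= x)%O]) \/
    (exists2 q : Gamma R, ~~ is_circ q /\ rational (gamma q) &
       B = [set x | (x <= q)%O])].

HB.instance Definition _ (R : realType) :=
  @isSubBaseTopological.Build (Gamma R) (set (Gamma R)) (@Gamma_subbasis R) id.

(* Only meaningful on the domain {(x, y) | y <= x}, where the arguments of circ
   and minus below are always in range; see gamma_ominus and is_circ_ominus. *)
Definition ominus (R : realType) (x y : Gamma R) : Gamma R :=
  let d := gamma x - gamma y in
  if is_circ y then (if is_circ x then circ d else minus d)
  else if d \in @rational R then circ d else minus d.

Definition oslash (R : realType) (x y : Gamma R) : Gamma R :=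
  supremum (Gamma_zero R)
    [set ominus x q | q in [set q | [/\ is_circ q, (y < q)%O & (q <= x)%O]]].

Lemma ominus_in_range (R : realType) (x y : Gamma R) :
  (y <= x)%O -> let d := gamma x - gamma y in
  [/\ 0 <= d <= 1,
      is_circ x -> is_circ y -> rational d,
      ~~ is_circ x -> is_circ y -> 0 < d &
      ~ rational d -> 0 < d].
Proof.
move=> yx d; have d01 : 0 <= d <= 1.
  rewrite subr_ge0 gamma_homo //= lerBlDr.
  by apply: le_trans (gamma_le1 x) _; rewrite lerDl gamma_ge0.
split => //.
- by move=> /Gamma_circP[_ rx] /Gamma_circP[_ ry]; apply: rationalB.
- by move: yx; rewrite Gamma_leE subr_gt0 => + xm yc; rewrite yc xm.
- move=> dr; have /andP[d0 _] := d01; rewrite lt_neqAle d0 andbT.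
  by apply/eqP => dE; apply: dr; rewrite -dE; apply: rational0.
Qed.

Lemma gamma_ominus (R : realType) (x y : Gamma R) :
  (y <= x)%O -> gamma (ominus x y) = gamma x - gamma y.
Proof.
move=> /ominus_in_range[d01 h1 h2 h3]; have /andP[_ d1] := d01; rewrite /ominus.
have [yc|yc] := boolP (is_circ y).
  have [xc|xc] := boolP (is_circ x).
    by rewrite gamma_circ //; apply: h1.
  by rewrite gamma_minus // h2.
case: ifPn => [/set_mem dr|/negP dr].
  by rewrite gamma_circ.
by rewrite gamma_minus // h3 //= => ?; apply: dr; apply: mem_set.
Qed.

Lemma is_circ_ominus (R : realType) (x y : Gamma R) : (y <= x)%O ->
  is_circ (ominus x y) =
    if is_circ y then is_circ x else gamma x - gamma y \in @rational R.
Proof.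
move=> /ominus_in_range[d01 h1 h2 h3]; have /andP[_ d1] := d01; rewrite /ominus.
have [yc|yc] := boolP (is_circ y).
  have [xc|xc] := boolP (is_circ x); first by rewrite is_circ_circ.
  by rewrite is_circ_minus // h2.
case: ifPn => [/set_mem dr|/negP dr]; first by rewrite is_circ_circ.
by rewrite is_circ_minus // h3 //= => ?; apply: dr; apply: mem_set.
Qed.

Lemma rational_between (R : realType) (a b : R) :
  a < b -> exists2 q, rational q & a < q < b.
Proof.
move=> /rat_in_itvoo[q]; rewrite in_itv /= => aqb.
by exists (ratr q) => //; exists q.
Qed.

Lemma circ_between (R : realType) (x y : Gamma R) (a b : R) :
  gamma y <= a -> a < b -> b <= gamma x ->
  exists q : Gamma R, [/\ is_circ q, (y < q)%O, (q <= x)%O & a < gamma q < b].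
Proof.
move=> ya /rational_between[q ratq /andP[aq qb]] bx.
have q01 : 0 <= q <= 1.
  rewrite (le_trans (gamma_ge0 y)) ?(le_trans ya) ?(ltW aq) //=.
  by rewrite (le_trans (ltW qb)) // (le_trans bx) // gamma_le1.
have yq : gamma y < q by apply: le_lt_trans aq.
have qx : q < gamma x by apply: lt_le_trans bx.
exists (circ q); split; first exact: is_circ_circ.
- by rewrite Gamma_ltE gamma_circ //; case: ifP => // _; apply: ltW.
- by rewrite Gamma_leE gamma_circ //; case: ifP => // _; apply: ltW.
- by rewrite gamma_circ // aq.
Qed.

(* The proof exhibits the join defining oslash when its index set is nonempty:
   the default value of supremum is only used for the empty join. *)
Lemma gamma_oslash (R : realType) (x y : Gamma R) :
  (y <= x)%O -> gamma (oslash x y) = gamma x - gamma y.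
Proof.
move=> yx; rewrite /oslash.
set Q := (X in [set _ | _ in X]); set A := (X in supremum _ X).
have Qle q : Q q -> (q <= x)%O by case.
have [A0|/set0P[z0 Az0]] := eqVneq A set0.
  rewrite A0 supremum0; apply/esym/eqP.
  rewrite subr_eq0 eq_le [X in _ && X]gamma_homo // andbT.
  rewrite leNgt; apply/negP => xy.
  have [q [q1 q2 q3 _]] := circ_between (lexx _) xy (lexx _).
  have : A (ominus x q) by exists q.
  by rewrite A0.
suff [z Az gz] : exists2 z, supremums A z & gamma z = gamma x - gamma y.
  rewrite /supremum; case: ifP => [/eqP A0|_]; first by move: Az0; rewrite A0.
  case: xgetP => [w _ Aw|/(_ z)/(_ Az)//].
  by rewrite (is_subset1_supremums Aw Az).
have least u : ubound A u -> gamma x - gamma y <= gamma u.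
  move=> Au; rewrite leNgt; apply/negP => ud.
  have h1 : gamma y < gamma x - gamma u by rewrite ltrBrDr addrC -ltrBrDr.
  have h2 : gamma x - gamma u <= gamma x by rewrite gerBl gamma_ge0.
  have [q [q1 q2 q3 /andP[_ qu]]] := circ_between (lexx _) h1 h2.
  have /Au/gamma_homo : A (ominus x q) by exists q.
  by rewrite gamma_ominus // leNgt; apply/negP; rewrite negbK ltrBrDr addrC -ltrBrDr.
case: (pselect (exists2 q, Q q & gamma q = gamma y)) => [[q Qq qy]|nQ].
  exists (ominus x q); last by rewrite gamma_ominus ?qy //; apply: Qle.
  split; last by move=> u; apply; exists q.
  move=> _ [p Qp <-]; rewrite Gamma_leE.
  rewrite !gamma_ominus ?Qle // !is_circ_ominus ?Qle //.
  have [qc _ _] := Qq; have [pc yp _] := Qp; rewrite qc pc andbN qy lerB //.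
  by apply: gamma_homo; apply: ltW.
have [q Qq _] := Az0; have [qc yq qx] := Qq.
have Qlt p : Q p -> gamma y < gamma p.
  move=> Qp; have [_ /ltW/gamma_homo yp _] := Qp.
  rewrite lt_neqAle yp andbT; apply/eqP => E; apply: nQ; exists p => //.
have [d01 _ _ _] := ominus_in_range yx; have /andP[_ d1] := d01.
have d0 : 0 < gamma x - gamma y.
  by rewrite subr_gt0 (lt_le_trans (Qlt _ Qq)) // gamma_homo.
have dm : 0 < gamma x - gamma y <= 1 by rewrite d0.
exists (minus (gamma x - gamma y)); last exact: gamma_minus.
split.
  move=> _ [p Qp <-]; rewrite Gamma_leE gamma_minus // gamma_ominus ?Qle //.
  have h : gamma x - gamma p < gamma x - gamma y by rewrite ltrD2l ltrN2 Qlt.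
  by case: ifP => // _; apply: ltW.
by move=> u /least du; rewrite Gamma_leE gamma_minus // is_circ_minus.
Qed.

Definition Gamma_measure (R : realType) (d : Order.disp_t)
    (D : tbDistrLatticeType d) : set {ptws D -> Gamma R} :=
  [set mu | [/\ mu \bot%O = circ 0, mu \top%O = circ 1,
      (forall a b : D, (a <= b)%O -> (mu a <= mu b)%O),
      (forall a b : D, (oslash (mu a) (mu (a `&` b)%O)
         <= ominus (mu (a `|` b)%O) (mu b))%O) &
      (forall a b : D, (ominus (mu a) (mu (a `&` b)%O)
         >= oslash (mu (a `|` b)%O) (mu b))%O)]].

(* The [0, 1]-valued functions are taken among the R-valued ones: [0, 1]^D is
   a subspace of R^D. *)
Definition I_measure (R : realType) (d : Order.disp_t)
    (D : tbDistrLatticeType d) : set {ptws D -> R} :=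
  [set m | [/\ (forall a : D, 0 <= m a <= 1), m \bot%O = 0, m \top%O = 1,
      (forall a b : D, (a <= b)%O -> m a <= m b) &
      (forall a b : D, m a + m b = m (a `|` b)%O + m (a `&` b)%O)]].

Arguments Gamma_measure : clear implicits.
Arguments Gamma_measure R {d} D.
Arguments I_measure : clear implicits.
Arguments I_measure R {d} D.

(* M(D) and M_I(D) with the subspace topology, which set_type carries. *)
Definition M (R : realType) (d : Order.disp_t) (D : tbDistrLatticeType d) :
  topologicalType := set_type (Gamma_measure R D).
Definition M_I (R : realType) (d : Order.disp_t) (D : tbDistrLatticeType d) :
  topologicalType := set_type (I_measure R D).

Arguments M R {d} D.
Arguments M_I R {d} D.

Lemma L_gamma_subproof (R : realType) (d : Order.disp_t)
    (D : tbDistrLatticeType d) (mu : M R D) :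
  I_measure R D (fun a => gamma (set_val mu a)).
Proof.
have := set_valP mu; rewrite -[val mu]/(set_val mu).
move: (set_val mu) => {}mu [mu0 mu1 mono h1 h2]; split.
- by move=> a; rewrite gamma_ge0 gamma_le1.
- by rewrite mu0 gamma_circ ?lexx ?ler01 //; apply: rational0.
- by rewrite mu1 gamma_circ ?lexx ?ler01 //; apply: rational1.
- by move=> a b /mono/gamma_homo.
- move=> a b; have mI : (mu (a `&` b)%O <= mu a)%O by apply/mono/leIl.
  have mU : (mu b <= mu (a `|` b)%O)%O by apply/mono/leUr.
  have := gamma_homo (h1 a b); have := gamma_homo (h2 a b).
  rewrite !gamma_oslash // !gamma_ominus // => e1 e2.
  have /eqP : gamma (mu a) - gamma (mu (a `&` b)%O) =
         gamma (mu (a `|` b)%O) - gamma (mu b).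
    by apply/eqP; rewrite eq_le e1 e2.
  by rewrite subr_eq addrAC eq_sym subr_eq => /eqP.
Qed.

Definition L_gamma (R : realType) (d : Order.disp_t)
    (D : tbDistrLatticeType d) (mu : M R D) : M_I R D :=
  SigSub (mem_set (L_gamma_subproof mu)).

Record signature := Signature { symbol : Type; arity : symbol -> nat }.

(* The variable v_(i + 1) is represented by the natural number i. *)
Inductive formula (S : signature) : Type :=
| FEq of nat & nat
| FRel (p : symbol S) of (arity p).-tuple nat
| FBot
| FTop
| FNot of formula S
| FAnd of formula S & formula S
| FOr of formula S & formula S
| FImp of formula S & formula S
| FEx of nat & formula S
| FAll of nat & formula S.

Arguments FEq {S}.
Arguments FBot {S}.
Arguments FTop {S}.

Record structure (S : signature) := Structure {
  carrier :> Type;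
  interp : forall p : symbol S, (arity p).-tuple carrier -> Prop }.

Definition update (A : Type) (v : nat -> A) (i : nat) (a : A) : nat -> A :=
  fun j => if j == i then a else v j.

Fixpoint sat (S : signature) (A : structure S) (v : nat -> A) (phi : formula S) :
    Prop :=
  match phi with
  | FEq i j => v i = v j
  | FRel p xs => @interp S A p (map_tuple v xs)
  | FBot => False
  | FTop => True
  | FNot phi => ~ sat v phi
  | FAnd phi psi => sat v phi /\ sat v psi
  | FOr phi psi => sat v phi \/ sat v psi
  | FImp phi psi => sat v phi -> sat v psi
  | FEx i phi => exists a, sat (update v i a) phi
  | FAll i phi => forall a, sat (update v i a) phi
  end.

Fixpoint free_vars (S : signature) (phi : formula S) : seq nat :=
  match phi with
  | FEq i j => [:: i; j]
  | FRel p xs => xs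
  | FBot | FTop => [::]
  | FNot phi => free_vars phi
  | FAnd phi psi | FOr phi psi | FImp phi psi => free_vars phi ++ free_vars psi
  | FEx i phi | FAll i phi => [seq j <- free_vars phi | j != i]
  end.

(* Entailment and equivalence over all structures with all assignments. A
   structure with empty carrier has no assignment, so the quantification is
   effectively over nonempty structures. *)
Definition entails (S : signature) (phi psi : formula S) : Prop :=
  forall (A : structure S) (v : nat -> A), sat v phi -> sat v psi.

Definition log_equiv (S : signature) (phi psi : formula S) : bool :=
  `[< forall (A : structure S) (v : nat -> A), sat v phi <-> sat v psi >].

HB.instance Definition _ (S : signature) := gen_eqMixin (formula S).
HB.instance Definition _ (S : signature) := gen_choiceMixin (formula S).

Fact log_equiv_refl (S : signature) : reflexive (@log_equiv S).
Proof. by move=> phi; apply/asboolP. Qed.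

Fact log_equiv_sym (S : signature) : symmetric (@log_equiv S).
Proof.
by move=> phi psi; apply/asboolP/asboolP => h A v; split => /h.
Qed.

Fact log_equiv_trans (S : signature) : transitive (@log_equiv S).
Proof.
move=> psi phi chi /asboolP h1 /asboolP h2; apply/asboolP => A v.
by rewrite h1 h2.
Qed.

Canonical log_equiv_equiv (S : signature) :=
  EquivRel (@log_equiv S) (@log_equiv_refl S) (@log_equiv_sym S)
    (@log_equiv_trans S).

Definition FO (S : signature) := {eq_quot (@log_equiv S)}.

HB.instance Definition _ (S : signature) := Choice.on (FO S).
HB.instance Definition _ (S : signature) := EqQuotient.on (FO S).

Lemma sat_repr (S : signature) (phi : formula S) (A : structure S) (v : nat -> A) :
  sat v (repr (\pi_(FO S) phi)) <-> sat v phi.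
Proof.
have /eqmodP/asboolP h : repr (\pi_(FO S) phi) = phi %[mod FO S].
  by rewrite reprK.
exact: h.
Qed.

Lemma FO_eqP (S : signature) (c e : FO S) :
  (forall (A : structure S) (v : nat -> A), sat v (repr c) <-> sat v (repr e)) ->
  c = e.
Proof. by move=> h; rewrite -[c]reprK -[e]reprK; apply/eqmodP/asboolP. Qed.

Definition FO_le (S : signature) (c e : FO S) : bool :=
  `[< entails (repr c) (repr e) >].
Definition FO_meet (S : signature) (c e : FO S) : FO S :=
  \pi_(FO S) (FAnd (repr c) (repr e)).
Definition FO_join (S : signature) (c e : FO S) : FO S :=
  \pi_(FO S) (FOr (repr c) (repr e)).
Definition FO_compl (S : signature) (c : FO S) : FO S := \pi_(FO S) (FNot (repr c)).
Definition FO_bot (S : signature) : FO S := \pi_(FO S) FBot.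
Definition FO_top (S : signature) : FO S := \pi_(FO S) FTop.

Fact FO_le_refl (S : signature) : reflexive (@FO_le S).
Proof. by move=> c; apply/asboolP => A v. Qed.

Fact FO_le_anti (S : signature) : antisymmetric (@FO_le S).
Proof.
move=> c e /andP[/asboolP h1 /asboolP h2]; apply: FO_eqP => A v.
by split; [apply: h1|apply: h2].
Qed.

Fact FO_le_trans (S : signature) : transitive (@FO_le S).
Proof.
by move=> c b e /asboolP h1 /asboolP h2; apply/asboolP => A v /h1 /h2.
Qed.

Fact FO_display : Order.disp_t. Proof. exact: (Order.Disp tt tt). Qed.

HB.instance Definition _ (S : signature) := @Order.Le_isPOrder.Build FO_display
  (FO S) (@FO_le S) (@FO_le_refl S) (@FO_le_anti S) (@FO_le_trans S).

Fact FO_meetP (S : signature) (x y z : FO S) :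
  (x <= FO_meet y z)%O = (x <= y)%O && (x <= z)%O.
Proof.
apply/asboolP/andP => [h|[/asboolP h1 /asboolP h2] A v xv].
  by split; apply/asboolP => A v /h /sat_repr[].
by apply/sat_repr; split; [apply: h1|apply: h2].
Qed.

Fact FO_joinP (S : signature) (x y z : FO S) :
  (FO_join x y <= z)%O = (x <= z)%O && (y <= z)%O.
Proof.
apply/asboolP/andP => [h|[/asboolP h1 /asboolP h2] A v /sat_repr[/h1|/h2]//].
by split; apply/asboolP => A v xv; apply: h; apply/sat_repr; [left|right].
Qed.

HB.instance Definition _ (S : signature) :=
  @Order.POrder_MeetJoin_isLattice.Build FO_display (FO S)
    (@FO_meet S) (@FO_join S) (@FO_meetP S) (@FO_joinP S).

Lemma sat_meet (S : signature) (x y : FO S) (A : structure S) (v : nat -> A) :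
  sat v (repr (x `&` y)%O) <-> sat v (repr x) /\ sat v (repr y).
Proof. exact: sat_repr. Qed.

Lemma sat_join (S : signature) (x y : FO S) (A : structure S) (v : nat -> A) :
  sat v (repr (x `|` y)%O) <-> sat v (repr x) \/ sat v (repr y).
Proof. exact: sat_repr. Qed.

Fact FO_meetUl (S : signature) :
  left_distributive (@Order.meet _ (FO S)) (@Order.join _ (FO S)).
Proof.
move=> x y z; apply: FO_eqP => A v.
by rewrite sat_join !sat_meet sat_join; tauto.
Qed.

HB.instance Definition _ (S : signature) :=
  @Order.Lattice_Meet_isDistrLattice.Build FO_display (FO S) (@FO_meetUl S).

Fact FO_le0x (S : signature) (x : FO S) : (FO_bot S <= x)%O.
Proof. by apply/asboolP => A v /sat_repr. Qed.

Fact FO_lex1 (S : signature) (x : FO S) : (x <= FO_top S)%O.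
Proof. by apply/asboolP => A v _; apply/sat_repr. Qed.

HB.instance Definition _ (S : signature) :=
  @Order.hasBottom.Build FO_display (FO S) (FO_bot S) (@FO_le0x S).
HB.instance Definition _ (S : signature) :=
  @Order.hasTop.Build FO_display (FO S) (FO_top S) (@FO_lex1 S).

Fact FO_joinxC (S : signature) (x : FO S) : (x `|` FO_compl x = \top)%O.
Proof.
apply: FO_eqP => A v; rewrite sat_join !sat_repr /=; split=> // _.
exact: EM.
Qed.

Fact FO_meetxC (S : signature) (x : FO S) : (x `&` FO_compl x = \bot)%O.
Proof.
by apply: FO_eqP => A v; rewrite sat_meet !sat_repr /=; tauto.
Qed.

HB.instance Definition _ (S : signature) :=
  @Order.TBDistrLattice_hasComplement.Build FO_display (FO S)
    (@FO_compl S) (@FO_joinxC S) (@FO_meetxC S).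

Record fin_structure (S : signature) := FinStructure {
  fin_carrier : finType;
  fin_interp : forall p : symbol S, (arity p).-tuple fin_carrier -> Prop;
  fin_nonempty : (0 < #|fin_carrier|)%N }.

Definition structure_of_fin (S : signature) (A : fin_structure S) : structure S :=
  @Structure S (fin_carrier A) (@fin_interp S A).
Coercion structure_of_fin : fin_structure >-> structure.

(* A |= phi(a_1, ..., a_n): phi holds under the assignments v_i |-> a_i, whatever
   the values of the other variables. *)
Definition tuple_sat (S : signature) (A : structure S) (n : nat)
    (phi : formula S) (t : n.-tuple A) : Prop :=
  forall v : nat -> A, (forall i : 'I_n, v i = tnth t i) -> sat v phi.

Definition stone_ratio (R : realType) (S : signature) (n : nat)
    (phi : formula S) (A : fin_structure S) : R :=
  #|[set t : n.-tuple (fin_carrier A) | `[< @tuple_sat S A n phi t >]]%SET|%:R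
  / (#|fin_carrier A| ^ n)%:R.

(* The least n such that all free variables of phi are among the first n ones;
   see stone_pairE for the independence of the choice of n and phi. *)
Definition num_vars (S : signature) (phi : formula S) : nat :=
  \max_(i <- free_vars phi) i.+1.

Definition stone_pair (R : realType) (S : signature) (A : fin_structure S)
    (c : FO S) : R :=
  stone_ratio R (num_vars (repr c)) (repr c) A.

Lemma sat_coincidence (S : signature) (A : structure S) (phi : formula S)
    (v w : nat -> A) :
  {in free_vars phi, v =1 w} -> sat v phi <-> sat w phi.
Proof.
elim: phi v w => /=.
- by move=> i j v w vw; rewrite !vw // !inE eqxx ?orbT.
- move=> p xs v w vw; suff -> : map_tuple v xs = map_tuple w xs by [].
  by apply: val_inj; apply/eq_in_map.
- by [].
- by [].
- by move=> phi IH v w /IH ->.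
- move=> phi IH psi IH' v w vw.
  by rewrite (IH v w) ?(IH' v w) // => i hi; apply: vw; rewrite mem_cat hi ?orbT.
- move=> phi IH psi IH' v w vw.
  by rewrite (IH v w) ?(IH' v w) // => i hi; apply: vw; rewrite mem_cat hi ?orbT.
- move=> phi IH psi IH' v w vw.
  by rewrite (IH v w) ?(IH' v w) // => i hi; apply: vw; rewrite mem_cat hi ?orbT.
- move=> i phi IH v w vw.
  have h a : sat (update v i a) phi <-> sat (update w i a) phi.
    apply: IH => j hj; rewrite /update; case: eqP => // /eqP ji.
    by apply: vw; rewrite mem_filter ji.
  by split=> -[a /h ha]; exists a.
- move=> i phi IH v w vw.
  have h a : sat (update v i a) phi <-> sat (update w i a) phi.
    apply: IH => j hj; rewrite /update; case: eqP => // /eqP ji.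
    by apply: vw; rewrite mem_filter ji.
  by split=> ha a; apply/h.
Qed.

Lemma lt_num_vars (S : signature) (phi : formula S) (i : nat) :
  i \in free_vars phi -> (i < num_vars phi)%N.
Proof. by move=> hi; apply: (leq_bigmax_seq (F := succn)). Qed.

Lemma tuple_satE (S : signature) (A : structure S) (phi : formula S) (n : nat)
    (t : n.-tuple A) (v : nat -> A) :
  (num_vars phi <= n)%N -> (forall i : 'I_n, v i = tnth t i) ->
  tuple_sat phi t <-> sat v phi.
Proof.
move=> hn vt; split=> [|hv w wt]; first exact.
apply: (proj1 (@sat_coincidence S A phi v w _)) hv => i /lt_num_vars hi.
have ii : (i < n)%N by apply: leq_trans hn.
by rewrite (vt (Ordinal ii)) (wt (Ordinal ii)).
Qed.

Lemma fin_point (S : signature) (A : fin_structure S) : fin_carrier A.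
Proof. by have /card_gt0P/cid[] := fin_nonempty A. Qed.

Lemma tuple_sat_nth (S : signature) (A : fin_structure S) (phi : formula S)
    (n : nat) (t : n.-tuple A) : (num_vars phi <= n)%N ->
  tuple_sat phi t <-> @sat S A (nth (fin_point A) t) phi.
Proof. by move=> hn; apply: tuple_satE => // i; rewrite -tnth_nth. Qed.

Lemma stone_ratioS (R : realType) (S : signature) (n : nat) (phi : formula S)
    (A : fin_structure S) : (num_vars phi <= n)%N ->
  stone_ratio R n.+1 phi A = stone_ratio R n phi A.
Proof.
move=> hn; rewrite /stone_ratio.
set X := (X in #|pred_of_set X|%:R / (_ ^ n.+1)%:R).
set Y := (X in _ = #|pred_of_set X|%:R / _).
have -> : X =
    [set rcons_tuple p.2 p.1 | p in finset.setX [set: fin_carrier A]%SET Y]%SET.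
  apply/setP => t; apply/idP/imsetP => [|[[a s]]].
  - rewrite finset.in_set => /asboolP /(tuple_sat_nth _ (leqW hn)) ht.
    have ht0 : size (take n t) == n by rewrite size_takel // size_tuple.
    exists (nth (fin_point A) t n, Tuple ht0); last first.
      apply: val_inj; rewrite /= -take_nth ?size_tuple //.
      by rewrite take_oversize // size_tuple.
    rewrite finset.in_setX finset.in_setT finset.in_set /=.
    apply/asboolP; apply: (proj2 (tuple_sat_nth _ hn)).
    apply: (proj1 (@sat_coincidence S A phi _ _ _)) ht => i /lt_num_vars hi /=.
    by rewrite nth_take // (leq_trans hi).
  - rewrite finset.in_setX finset.in_setT finset.in_set /= => /asboolP.
    move=> /(tuple_sat_nth _ hn) hs ->; rewrite finset.in_set.
    apply/asboolP; apply: (proj2 (tuple_sat_nth _ (leqW hn))).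
    apply: (proj1 (@sat_coincidence S A phi _ _ _)) hs => i /lt_num_vars hi /=.
    by rewrite nth_rcons size_tuple (leq_trans hi hn).
rewrite card_imset; last first.
  by move=> [a s] [b u] /(congr1 val)/rcons_inj[/val_inj -> ->].
rewrite cardsX cardsT expnS !natrM invfM mulrACA divff ?mul1r //.
by rewrite pnatr_eq0 -lt0n fin_nonempty.
Qed.

Lemma stone_ratio_indep (R : realType) (S : signature) (n : nat) (phi : formula S)
    (A : fin_structure S) : (num_vars phi <= n)%N ->
  stone_ratio R n phi A = stone_ratio R (num_vars phi) phi A.
Proof.
elim: n => [|n IH]; first by rewrite leqn0 => /eqP ->.
rewrite leq_eqVlt => /orP[/eqP -> //|]; rewrite ltnS => hn.
by rewrite stone_ratioS // IH.
Qed.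

Lemma stone_pairE (R : realType) (S : signature) (A : fin_structure S)
    (phi : formula S) (n : nat) : {in free_vars phi, forall i, (i < n)%N} ->
  stone_pair R A (\pi_(FO S) phi) = stone_ratio R n phi A.
Proof.
move=> hn; have {}hn : (num_vars phi <= n)%N by apply/bigmax_leqP_seq => i /hn.
rewrite /stone_pair; set psi := repr _.
pose N := maxn n (num_vars psi).
rewrite -(stone_ratio_indep R A (leq_maxr n _)) -/N.
rewrite (stone_ratio_indep R A hn).
rewrite -(stone_ratio_indep R A (leq_trans hn (leq_maxl n (num_vars psi)))).
rewrite -/N /stone_ratio; congr (_%:R / _).
apply: eq_card => t; rewrite !finset.in_set.
by apply/asboolP/asboolP => h v /h /sat_repr.
Qed.

Lemma stone_pair_ratio (R : realType) (S : signature) (A : fin_structure S)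
    (c : FO S) (n : nat) : (num_vars (repr c) <= n)%N ->
  stone_pair R A c = stone_ratio R n (repr c) A.
Proof. by move=> hn; rewrite (stone_ratio_indep R A hn). Qed.

Lemma stone_pair_measure (R : realType) (S : signature) (A : fin_structure S) :
  I_measure R (FO S) (stone_pair R A).
Proof.
pose X n (c : FO S) :=
  [set t : n.-tuple (fin_carrier A) | `[< @tuple_sat S A n (repr c) t >]]%SET.
have XE n c t : (num_vars (repr c) <= n)%N ->
    t \in X n c <-> @sat S A (nth (fin_point A) t) (repr c).
  move=> hn; rewrite finset.in_set; split=> [/asboolP/tuple_sat_nth|]; first exact.
  by move=> /(tuple_sat_nth _ hn) ?; apply/asboolP.
have cardT n : #|[set: n.-tuple (fin_carrier A)]%SET| = (#|fin_carrier A| ^ n)%N.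
  by rewrite cardsT card_tuple.
have A0 n : 0 < (#|fin_carrier A| ^ n)%:R :> R.
  by rewrite ltr0n expn_gt0 fin_nonempty.
split.
- move=> c; rewrite /stone_pair /stone_ratio divr_ge0 //= ler_pdivrMr // mul1r.
  by rewrite ler_nat -cardT; apply: subset_leq_card; rewrite finset.subsetT.
- rewrite /stone_pair /stone_ratio -/(X _ _); apply/eqP; rewrite mulf_eq0.
  rewrite pnatr_eq0 cards_eq0; apply/orP; left; apply/eqP/setP => t.
  by rewrite finset.in_set0; apply/negP => /XE-/(_ (leqnn _))/sat_repr.
- rewrite /stone_pair /stone_ratio -/(X _ _) -cardT.
  have -> : X (num_vars (repr (\top%O : FO S))) \top%O = [set: _]%SET.
    by apply/setP => t; rewrite finset.in_setT; apply/XE => //; apply/sat_repr.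
  by rewrite divff // cardT gt_eqF.
- move=> a b ab; pose n := maxn (num_vars (repr a)) (num_vars (repr b)).
  rewrite !(@stone_pair_ratio _ _ _ _ n) ?leq_maxl ?leq_maxr //.
  rewrite /stone_ratio -/(X n a) -/(X n b) ler_pM2r ?invr_gt0 // ler_nat.
  apply/subset_leq_card/fintype.subsetP => t /XE; rewrite leq_maxl => /(_ isT) ha.
  by apply/XE; rewrite ?leq_maxr //; move/asboolP: ab; apply.
- move=> a b.
  pose n := maxn (maxn (num_vars (repr a)) (num_vars (repr b)))
    (maxn (num_vars (repr (a `|` b)%O)) (num_vars (repr (a `&` b)%O))).
  have ha : (num_vars (repr a) <= n)%N by rewrite !leq_max leqnn.
  have hb : (num_vars (repr b) <= n)%N by rewrite !leq_max leqnn orbT.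
  have hU : (num_vars (repr (a `|` b)%O) <= n)%N.
    by rewrite !leq_max leqnn !orbT.
  have hI : (num_vars (repr (a `&` b)%O) <= n)%N.
    by rewrite !leq_max leqnn !orbT.
  rewrite !(@stone_pair_ratio _ _ _ _ n) //.
  rewrite /stone_ratio -!mulrDl -!natrD; congr (_%:R / _).
  rewrite -!/(X n _).
  have -> : X n (a `|` b)%O = (X n a :|: X n b)%SET.
    apply/setP => t; rewrite finset.in_setU; apply/idP/orP.
      by move=> /XE-/(_ hU)/sat_join[] h; [left|right]; apply/XE.
    by case=> /XE h; apply/XE => //; apply/sat_join; [left|right]; apply: h.
  have -> : X n (a `&` b)%O = (X n a :&: X n b)%SET.
    apply/setP => t; rewrite finset.in_setI; apply/idP/andP.
      by move=> /XE-/(_ hI)/sat_meet[] h1 h2; split; apply/XE.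
    move=> [/XE-/(_ ha) h1 /XE-/(_ hb) h2].
    by apply/XE => //; apply/sat_meet.
  by rewrite cardsUI.
Qed.

Definition stone_pairing_I (R : realType) (S : signature) (A : fin_structure S) :
    M_I R (FO S) :=
  SigSub (mem_set (stone_pair_measure R A)).

Lemma stone_pair_rational (R : realType) (S : signature) (A : fin_structure S)
    (c : FO S) : rational (stone_pair R A c).
Proof.
rewrite /stone_pair /stone_ratio; set k := #|_|; set l := (_ ^ _)%N.
by exists (k%:R / l%:R) => //; rewrite fmorph_div /= !ratr_nat.
Qed.

Lemma Gamma_stone_pair_measure (R : realType) (S : signature)
    (A : fin_structure S) :
  Gamma_measure R (FO S) (fun c => circ (stone_pair R A c)).
Proof.
have [p01 p0 p1 pmono padd] := stone_pair_measure R A.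
have pE c : gamma (circ (stone_pair R A c)) = stone_pair R A c.
  by apply: gamma_circ; [exact: p01|exact: stone_pair_rational].
pose mu (c : FO S) := circ (stone_pair R A c).
have mono (a b : FO S) : (a <= b)%O -> (mu a <= mu b)%O.
  by move=> ab; rewrite Gamma_leE !is_circ_circ /= !pE pmono.
have mI (a b : FO S) : (mu (a `&` b) <= mu a)%O by apply/mono/leIl.
have mU (a b : FO S) : (mu b <= mu (a `|` b))%O by apply/mono/leUr.
have add (a b : FO S) : stone_pair R A a - stone_pair R A (a `&` b)%O =
    stone_pair R A (a `|` b)%O - stone_pair R A b.
  by apply/eqP; rewrite subr_eq addrAC eq_sym subr_eq eq_sym padd.
split; rewrite ?p0 ?p1 //.
- move=> a b; rewrite Gamma_leE gamma_oslash ?mI // gamma_ominus ?mU //.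
  by rewrite is_circ_ominus ?mU // !is_circ_circ andbF !pE add.
- move=> a b; rewrite Gamma_leE gamma_oslash ?mU // gamma_ominus ?mI //.
  by rewrite is_circ_ominus ?mI // !is_circ_circ andbF !pE add.
Qed.

Definition stone_pairing_Gamma (R : realType) (S : signature)
    (A : fin_structure S) : M R (FO S) :=
  SigSub (mem_set (Gamma_stone_pair_measure R A)).

(* Main.v *)
(* The map gamma, hence L_gamma, is continuous, which gives one inclusion. For
   the other, let m be in the closure of V. It is the image of an ultrafilter G
   on M(FO) containing U. For every formula c, the o-marked values nu(c), nu in
   U, converge along G to an element of Gamma of value m(c), marked o if m(c) is
   rational and eventually m(c) <= nu(c), and marked - otherwise. This pointwise
   limit is a Gamma-valued measure: the inequalities between oslash and ominus
   could only fail if eventually nu(a) - nu(a /\ b) and nu(a \/ b) - nu(b) were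
   strictly on different sides of their common limit, but they are equal. *)

Require Import Defs.
From mathcomp Require Import all_boot all_order all_algebra.
From mathcomp Require Import finmap.
From mathcomp Require Import all_classical all_reals all_analysis.
From mathcomp Require Import ring lra.

Set Implicit Arguments.
Unset Strict Implicit.
Unset Printing Implicit Defensive.

Import Order.TTheory GRing.Theory Num.Theory.
Import numFieldNormedType.Exports.

Local Open Scope ring_scope.
Local Open Scope classical_set_scope.

(** * Convergence in subspaces of products *)

(** Subspace and product topologies are both initial, so convergence is tested through the inclusion
    and then through the coordinates. This serves both [M] and [M_I]. *)
Lemma cvg_ptws_set_type (D : eqType) (X : topologicalType)
    (A : set {ptws D -> X}) (F : set_system (set_type A)) (x : set_type A) :
  Filter F ->
  F --> x <-> forall c : D, set_val y c @[y --> F] --> set_val x c.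
Proof.
move=> FF; split=> [Fx c|Fx].
  apply: cvg_trans (cvg_app _ Fx) _.
  apply: (@continuous_comp _ _ _ (set_val : set_type A -> {ptws D -> X}) (proj c)).
    exact: initial_continuous.
  exact: proj_continuous.
move=> B [_ [[C oC <-] Cx CB]]; apply: filterS CB _.
have : (set_val : _ -> {ptws D -> X}) @ F --> (set_val x : {ptws D -> X}).
  apply/cvg_sup => c E [_ [[W oW <-] Wx WE]]; apply: filterS WE _.
  by apply: Fx; apply: open_nbhs_nbhs.
by apply; apply: open_nbhs_nbhs.
Qed.

Lemma image_closure (X Y : topologicalType) (f : X -> Y) (A : set X) :
  continuous f -> f @` closure A `<=` closure (f @` A).
Proof.
move=> cf _ [x Ax <-] B /cf /Ax[y [Ay By]].
by exists (f y); split=> //; exists y.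
Qed.

(** * The topology of [Gamma] and the continuity of [gamma] *)

Section Gamma_topology.
Variable R : realType.
Implicit Types x y : Gamma R.

(** Every neighbourhood of [x] contains a finite intersection of subbasic sets around [x], and
    filters are closed under finite intersections. *)
Lemma cvg_Gamma (F : set_system (Gamma R)) x : Filter F ->
  (forall B, Gamma_subbasis B -> B x -> F B) -> F --> x.
Proof.
move=> FF Fx A; rewrite nbhsE => -[_ [[B sB <-] [C BC Cx]] sUBA].
rewrite nbhs_filterE; apply: filterS sUBA _; apply: (@filterS _ _ _ C).
  by move=> ? ?; exists C.
have /sB [E sE IEC] := BC; rewrite -IEC; apply: filter_bigI => H EH.
have /sE := EH; rewrite inE => sH.
by apply: Fx => //; move: Cx; rewrite -IEC => /(_ _ EH).
Qed.

Lemma nbhs_Gamma_subbasis x (B : set (Gamma R)) :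
  Gamma_subbasis B -> B x -> nbhs x B.
Proof.
move=> sB Bx; apply: open_nbhs_nbhs; split=> //; exists [set B]; last first.
  by rewrite predeqE => ?; split=> [[_ ->]|] //; exists B.
move=> _ ->; exists [fset B]%fset.
  by move=> ?; rewrite inE inE => /eqP->.
by rewrite predeqE=> ?; split=> [|??]; [apply|]; rewrite /= inE // =>/eqP->.
Qed.

(** Rationals [q] within [e] of [gamma x] give subbasic sets around [x]: the elements above [circ q]
    for [q] on the left, those below [minus q] for [q] on the right. *)
Lemma cvg_gamma (F : set_system (Gamma R)) x : Filter F ->
  (forall B, Gamma_subbasis B -> B x -> F B) -> gamma y @[y --> F] --> gamma x.
Proof.
move=> FF Fsub; apply/cvgrPdist_lt => e e0.
have lo : \forall y \near F, gamma x - e < gamma y.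
  (* If [gamma x - e] is negative, a rational just above it may fall outside the range of [circ];
     the bound is then trivial. *)
  have [x0|x0] := ltP (gamma x - e) 0.
    by apply: nearW => y; apply: lt_le_trans x0 (gamma_ge0 y).
  have [|q ratq /andP[xq qx]] := @rational_between R (gamma x - e) (gamma x).
    by rewrite ltrBlDr ltrDl.
  have q01 : 0 <= q <= 1.
    by rewrite (le_trans x0 (ltW xq)) (le_trans (ltW qx)) ?gamma_le1.
  apply: filterS (Fsub [set y | (circ q <= y)%O] _ _).
  - by move=> y /gamma_homo; rewrite gamma_circ //; apply: lt_le_trans.
  - by left; exists (circ q) => //; apply: is_circ_circ.
  - by rewrite /= Gamma_leE gamma_circ // qx (ltW qx) if_same.
have hi : \forall y \near F, gamma y < gamma x + e.
  have [x1|x1] := ltP 1 (gamma x + e).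
    by apply: nearW => y; apply: le_lt_trans (gamma_le1 y) x1.
  have [|q ratq /andP[xq qx]] := @rational_between R (gamma x) (gamma x + e).
    by rewrite ltrDl.
  have q01 : 0 < q <= 1.
    by rewrite (le_lt_trans (gamma_ge0 x) xq) (le_trans (ltW qx)).
  apply: filterS (Fsub [set y | (y <= minus q)%O] _ _).
  - by move=> y /gamma_homo; rewrite gamma_minus // => /le_lt_trans; apply.
  - by right; exists (minus q) => //; rewrite is_circ_minus // gamma_minus.
  - by rewrite /= Gamma_leE gamma_minus // xq (ltW xq) if_same.
near=> y; rewrite ltr_distlC; apply/andP; split.
  by near: y.
by near: y.
Unshelve. all: by end_near. Qed.

Lemma gamma_continuous : continuous (@gamma R).
Proof. move=> x; exact: cvg_gamma (nbhs_filter x) (@nbhs_Gamma_subbasis x). Qed.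

End Gamma_topology.

Lemma L_gamma_continuous (R : realType) (d : Order.disp_t)
    (D : tbDistrLatticeType d) : continuous (@L_gamma R d D).
Proof.
move=> mu; have muF : Filter (nbhs mu) := nbhs_filter mu.
have LF : Filter (@L_gamma R d D @ nbhs mu) by apply: fmap_filter.
apply/(@cvg_ptws_set_type _ _ (I_measure R D) _ (L_gamma mu) LF) => c.
apply: (@continuous_comp _ _ _ (fun nu : M R D => set_val nu c) (@gamma R)).
  exact: (@cvg_ptws_set_type _ _ (Gamma_measure R D) _ mu muF).1.
exact: gamma_continuous.
Qed.

(** * Marks of the two differences *)

Section oslash_ominus.
Variable R : realType.
Implicit Types x y : Gamma R.

(** As [gamma y < gamma x], the value of [oslash x y] is positive, so [oslash x y] is a true join
    and not the default [Gamma_zero]. *)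
Lemma oslash_le_ubound x y u : (y <= x)%O -> gamma y < gamma x ->
  (forall q, is_circ q -> (y < q)%O -> (q <= x)%O -> (ominus x q <= u)%O) ->
  (oslash x y <= u)%O.
Proof.
move=> yx ltyx ub.
have : 0 < gamma (oslash x y) by rewrite gamma_oslash // subr_gt0.
have g0 : gamma (Gamma_zero R) = 0 by [].
rewrite /oslash /supremum; case: ifP => _; first by rewrite g0 ltxx.
case: xgetP => [w _ [_ wlub] _|_]; last by rewrite g0 ltxx.
by apply: wlub => _ [q [qc yq qx] <-]; apply: ub.
Qed.

(** For all other marks of [x] and [y], each [ominus x q] lies below the [-] element of value
    [gamma x - gamma y], hence so does the join; the [o] element of that value does not. *)
Lemma is_circ_oslash x y : (y <= x)%O -> gamma y < gamma x ->
  is_circ (oslash x y) -> is_circ x /\ ~~ is_circ y.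
Proof.
move=> yx ltyx oc; apply/andP; apply: contraTT oc => nxy.
have [d01 _ _ _] := ominus_in_range yx; have /andP[_ d1] := d01.
have dm : 0 < gamma x - gamma y <= 1 by rewrite subr_gt0 ltyx.
suff : (oslash x y <= minus (gamma x - gamma y))%O.
  rewrite Gamma_leE is_circ_minus // gamma_minus // gamma_oslash // andbT.
  by case: ifP => //; rewrite ltxx.
apply: oslash_le_ubound => // q qc yq qx.
rewrite Gamma_leE is_circ_minus // is_circ_ominus // qc andbT gamma_minus //.
rewrite gamma_ominus //; move: yq; rewrite Gamma_ltE qc andbT.
(* If [x] is marked [-], so is [ominus x q], and a weak inequality suffices. Otherwise [y] is marked
   [o], and [y < q] is strict in value. *)
move: nxy; case: (is_circ x) => /=; last first.
  by move=> _; case: ifP => _ yq; rewrite lerD2l lerN2 // ltW.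
by rewrite negbK => ->; rewrite ltrD2l ltrN2.
Qed.

(** The values agree, so the only possible failure is an [o] on the left against a [-] on the right,
    and this forces the configuration excluded by the last hypothesis. *)
Lemma oslash_le_ominus x y x' y' : (y <= x)%O -> (y' <= x')%O ->
  gamma x - gamma y = gamma x' - gamma y' ->
  ~ [/\ is_circ x, ~~ is_circ y /\ rational (gamma y), is_circ y' &
        ~~ is_circ x' /\ rational (gamma x')] ->
  (oslash x y <= ominus x' y')%O.
Proof.
move=> yx yx' dE nxy; rewrite Gamma_leE gamma_oslash // gamma_ominus // dE lexx.
case: ifP => // /andP[oc]; rewrite is_circ_ominus //.
have [_] := Gamma_circP oc; rewrite gamma_oslash // => ratd.
have [yc'|_] := boolP (is_circ y'); last by rewrite -dE mem_set.
move=> xc'; exfalso.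
have ltyx' : gamma y' < gamma x' by move: yx'; rewrite Gamma_leE yc' xc'.
have ltyx : gamma y < gamma x by rewrite -subr_gt0 dE subr_gt0.
have [xc yc] := is_circ_oslash yx ltyx oc; apply: nxy.
have [_ ratx] := Gamma_circP xc; have [_ raty'] := Gamma_circP yc'.
split=> //; split=> //.
  by rewrite -[gamma y](subKr (gamma x)); apply: rationalB.
(* The sum is written with differences so that [rationalB] applies. *)
have -> : gamma x' = gamma y' - (0 - (gamma x - gamma y)) by rewrite dE; ring.
by do 2 (apply: rationalB => //); apply: rational0.
Qed.

End oslash_ominus.

(* A limit of elements q^o converging to l is l^o or l^- according as they
   eventually stay above l or below it. *)
Definition Gamma_lim (R : realType) (T : Type) (G : set_system T)
    (f : T -> Gamma R) (l : R) : Gamma R :=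
  if `[< rational l /\ G [set t | l <= gamma (f t)] >] then circ l else minus l.

(** * Limits in [Gamma] along an ultrafilter *)

Section Gamma_lim.
Variables (R : realType) (T : Type) (G : set_system T) (f : T -> Gamma R) (l : R).
Hypotheses (GU : UltraFilter G) (l01 : 0 <= l <= 1).
Hypothesis fl : gamma (f t) @[t --> G] --> l.

Let limP : gamma (Gamma_lim G f l) = l /\
  is_circ (Gamma_lim G f l) = `[< rational l /\ G [set t | l <= gamma (f t)] >].
Proof.
rewrite /Gamma_lim; case: asboolP => [[ratl _]|nl].
  by rewrite gamma_circ // is_circ_circ.
(* [minus 0] would be out of range, but for [l = 0] the test in [Gamma_lim] succeeds, all values
   being nonnegative. *)
have [/andP[l0 l1]] := (l01, nl); move: l0; rewrite le_eqVlt => /predU1P[l0|l0].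
  case: nl; rewrite -l0; split; first exact: rational0.
  by apply: filterS filterT => t _; apply: gamma_ge0.
by rewrite gamma_minus ?is_circ_minus // l0.
Qed.

Lemma gamma_Gamma_lim : gamma (Gamma_lim G f l) = l.
Proof. by case: limP. Qed.

Lemma is_circ_Gamma_lim : is_circ (Gamma_lim G f l) =
  `[< rational l /\ G [set t | l <= gamma (f t)] >].
Proof. by case: limP. Qed.

Lemma Gamma_lim_circ : is_circ (Gamma_lim G f l) ->
  \forall t \near G, l <= gamma (f t).
Proof. by rewrite is_circ_Gamma_lim => /asboolP[]. Qed.

Lemma Gamma_lim_minus : ~~ is_circ (Gamma_lim G f l) -> rational l ->
  \forall t \near G, gamma (f t) < l.
Proof.
rewrite is_circ_Gamma_lim => /asboolP nl ratl.
have [Gl|] := in_ultra_setVsetC [set t | l <= gamma (f t)] GU; first by case: nl.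
by apply: filterS => t /negP; rewrite -ltNge.
Qed.

(** At a subbasic threshold different from [l], convergence of the values decides membership; at a
    threshold equal to [l], the mark of the limit tells on which side the values eventually lie. *)
Lemma cvg_Gamma_lim : (\forall t \near G, is_circ (f t)) ->
  f @ G --> Gamma_lim G f l.
Proof.
move=> fc; apply: cvg_Gamma => B [[p pc ->]|[q [qm ratq] ->]] /=;
  rewrite Gamma_leE gamma_Gamma_lim.
- move=> pl; suff : \forall t \near G, (p <= f t)%O by [].
  move: pl; rewrite pc /=.
  have [lc|lm] := boolP (is_circ (Gamma_lim G f l)) => /= pl.
    apply: filterS2 _ fc (Gamma_lim_circ lc) => t ftc lt.
    by rewrite Gamma_leE ftc andbF (le_trans pl).
  apply: filterS2 _ fc (cvgr_gt _ fl _ pl) => t ftc lt.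
  by rewrite Gamma_leE ftc andbF ltW.
- rewrite qm andbT => lq.
  suff : \forall t \near G, gamma (f t) < gamma q.
    by apply: filterS => t tq; rewrite /= Gamma_leE tq (ltW tq) if_same.
  have [lq'|ql] := ltP l (gamma q); first exact: cvgr_lt lq'.
  move: lq; case: ifPn => [_|lm lq]; first by rewrite ltNge ql.
  have lqE : l = gamma q by apply/eqP; rewrite eq_le ql lq.
  by rewrite -lqE; apply: Gamma_lim_minus => //; rewrite lqE.
Qed.

End Gamma_lim.

(** * Lifting limits along [L_gamma] *)

Section L_gamma_closure.
Variables (R : realType) (d : Order.disp_t) (D : tbDistrLatticeType d).
Variables (U : set (M R D)) (m : M_I R D) (G : set_system (M R D)).
Hypothesis Ucirc : forall mu, U mu -> forall c, is_circ (set_val mu c).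
Hypotheses (GU : UltraFilter G) (GUU : G U) (Gm : @L_gamma R d D @ G --> m).

Let f (c : D) (nu : M R D) := set_val nu c.
Let lim (c : D) := Gamma_lim G (f c) (set_val m c).

Let m01 c : 0 <= set_val m c <= 1.
Proof. by have [m01 _ _ _ _] := set_valP m; apply: m01. Qed.

Let cvg_f c : gamma (f c nu) @[nu --> G] --> set_val m c.
Proof.
have /(@cvg_ptws_set_type _ _ (I_measure R D)) := Gm.
by move=> /(_ c).
Qed.

Let lim_circ c : is_circ (lim c) ->
  \forall nu \near G, set_val m c <= gamma (f c nu).
Proof. exact: Gamma_lim_circ. Qed.

Let lim_minus c : ~~ is_circ (lim c) -> rational (set_val m c) ->
  \forall nu \near G, gamma (f c nu) < set_val m c.
Proof. exact: Gamma_lim_minus. Qed.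

Let gamma_lim c : gamma (lim c) = set_val m c.
Proof. exact: gamma_Gamma_lim. Qed.

(** Failure requires equal values with [lim a] marked [o] and [lim b] marked [-]; some [nu] is then
    below the common value at [b] but not at [a], against its monotonicity. *)
Let lim_mono a b : (a <= b)%O -> (lim a <= lim b)%O.
Proof.
move=> ab; have [_ _ _ mmono _] := set_valP m.
rewrite Gamma_leE !gamma_lim; case: ifP => [/andP[ac bm]|_]; last exact: mmono.
rewrite lt_neqAle mmono // andbT; apply/eqP => mab.
have rata : rational (set_val m a).
  by rewrite -gamma_lim; apply: (Gamma_circP ac).2.
have ratb : rational (set_val m b) by rewrite -mab.
have [nu [ha hb]] := filter_ex (filterI (lim_circ ac) (lim_minus bm ratb)).
have [_ _ numono _ _] := set_valP nu.
have := gamma_homo (numono _ _ ab); rewrite leNgt => /negP; apply.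
by apply: lt_le_trans hb _; rewrite -mab.
Qed.

(** The two pairs are kept arbitrary so that both inequalities defining a measure are instances,
    with the pairs exchanged. *)
Let lim_sub x y x' y' : (y <= x)%O -> (y' <= x')%O ->
  set_val m x - set_val m y = set_val m x' - set_val m y' ->
  (forall nu : M R D, gamma (f x nu) - gamma (f y nu) =
     gamma (f x' nu) - gamma (f y' nu)) ->
  (oslash (lim x) (lim y) <= ominus (lim x') (lim y'))%O.
Proof.
move=> yx yx' mE fE; apply: oslash_le_ominus; rewrite ?gamma_lim //.
- exact: lim_mono.
- exact: lim_mono.
- move=> [xc [ym raty] yc' [xm' ratx']].
  (* For this [nu], the difference at [x], [y] exceeds the common limit while the difference at
     [x'], [y'] is smaller than it. *)
  have [nu [[hx hy] [hx' hy']]] := filter_ex (filterI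
    (filterI (lim_circ xc) (lim_minus ym raty))
    (filterI (lim_minus xm' ratx') (lim_circ yc'))).
  by move: (fE nu) hx hy hx' hy' mE => /=; lra.
Qed.

Let lim_measure : Gamma_measure R D lim.
Proof.
have := set_valP m; rewrite -[val m]/(set_val m) => -[_ m0 m1 _ madd].
have fadd (nu : M R D) a b :
    gamma (f a nu) + gamma (f b nu) =
    gamma (f (a `|` b)%O nu) + gamma (f (a `&` b)%O nu).
  by have [_ _ _ _ /(_ a b)] := L_gamma_subproof nu.
split.
- rewrite /lim /Gamma_lim m0 asboolT //; split; first exact: rational0.
  by apply: filterS filterT => nu _; apply: gamma_ge0.
- rewrite /lim /Gamma_lim m1 asboolT //; split; first exact: rational1.
  (* At [\top] every [nu] has value exactly 1, so the limit 1 is never approached strictly from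
     below. *)
  apply: filterS filterT => nu _ /=; have [_ nu1 _ _ _] := set_valP nu.
  by rewrite /f [set_val nu _]nu1 gamma_circ ?lexx ?ler01 //; apply: rational1.
- exact: lim_mono.
- move=> a b; apply: lim_sub; [exact: leIl|exact: leUr| |move=> nu].
    by have := madd a b; lra.
  by have := fadd nu a b; lra.
- move=> a b; apply: lim_sub; [exact: leUr|exact: leIl| |move=> nu].
    by have := madd a b; lra.
  by have := fadd nu a b; lra.
Qed.

Lemma L_gamma_ultrafilter_lift :
  exists2 mu : M R D, G --> mu & L_gamma mu = m.
Proof.
exists (SigSub (mem_set lim_measure)).
  apply/(@cvg_ptws_set_type _ _ (Gamma_measure R D)) => c.
  apply: (cvg_Gamma_lim GU (m01 c) (@cvg_f c)).
  by apply: filterS GUU => nu Unu; apply: Ucirc.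
by apply: val_inj; apply: funext => c; apply: gamma_lim.
Qed.

End L_gamma_closure.

Lemma L_gamma_closure (R : realType) (d : Order.disp_t)
    (D : tbDistrLatticeType d) (U : set (M R D)) :
  (forall mu, U mu -> forall c, is_circ (set_val mu c)) ->
  @L_gamma R d D @` closure U = closure (@L_gamma R d D @` U).
Proof.
move=> Ucirc; apply/seteqP; split.
  exact/image_closure/L_gamma_continuous.
move=> m Um.
(* Traces on [U] of the preimages of neighbourhoods of [m]: they are nonempty because [m] lies in
   the closure of the image. *)
pose F := filter_from (nbhs m) (fun B => U `&` @L_gamma R d D @^-1` B).
have FF : ProperFilter F.
  apply: filter_from_proper.
    apply: filter_from_filter; first by exists setT; apply: filterT.
    move=> B C mB mC; exists (B `&` C); first exact: filterI.
    by move=> mu [? []].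
  by move=> B /Um[_ [[mu Umu <-] Bmu]]; exists mu.
have [G [GU FG]] := ultraFilterLemma FF.
have GUU : G U by apply: FG; exists setT; [exact: filterT|move=> mu []].
have Gm : @L_gamma R d D @ G --> m.
  by move=> B mB; apply: FG; exists B => // mu [].
have [mu Gmu <-] := L_gamma_ultrafilter_lift Ucirc GU GUU Gm.
exists mu => // B /Gmu GB.
exact: filter_ex (filterI GUU GB).
Qed.

(** * Application to Stone pairings *)

Lemma L_gamma_stone_pairing (R : realType) (S : signature) (A : fin_structure S) :
  L_gamma (stone_pairing_Gamma R A) = stone_pairing_I R A.
Proof.
apply: val_inj; apply: funext => c; apply: gamma_circ.
  by have [] := stone_pair_measure R A.
exact: stone_pair_rational.
Qed.

Theorem theorem3 (R : realType) (S : signature) :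
  let U : set (M R (FO S)) :=
    [set mu | exists A : fin_structure S, mu = stone_pairing_Gamma R A] in
  let V : set (M_I R (FO S)) :=
    [set m | exists A : fin_structure S, m = stone_pairing_I R A] in
  @L_gamma R _ (FO S) @` closure U = closure V.
Proof.
move=> U V; rewrite L_gamma_closure.
  congr closure; apply/seteqP; split=> [_ [_ [A ->] <-]|_ [A ->]].
    by exists A; apply: L_gamma_stone_pairing.
  by exists (stone_pairing_Gamma R A); [exists A|exact: L_gamma_stone_pairing].
by move=> _ [A ->] c; apply: is_circ_circ.
Qed.
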